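(* The construction $\mathbf S$, sending a chained projection groupoid $(P,\mathcal G,\varepsilon)$ to $\mathbf S(P,\mathcal G,\varepsilon)$ and a chained projection functor to itself (as a map of underlying sets), is a functor $\mathbf{CPG}\to\mathbf{RSS}$ from the category of chained projection groupoids to the category of regular $*$-semigroups.
   Context: **Regular $*$-semigroups.** A regular $*$-semigroup is a semigroup $S$ with a unary operation $a\mapsto a^*$ such that $(a^* )^*=a=aa^*a$ and $(ab)^*=b^*a^*$ for all $a,b\in S$. A $*$-semigroup homomorphism is a map preserving the product and $^*$. $\mathbf{RSS}$ is the resulting category. **Conventions.** Small categories are identified with their sets of morphisms, and objects with identity morphisms; $v\mathcal G$ is the object set, $\mathbf d(a),\mathbf r(a)$ are domain and codomain, and $a\circ b$ is composed left to right (defined iff $\mathbf r(a)=\mathbf d(b)$). Maps are written to the right of their arguments and composed left to right, except evaluation maps $\varepsilon$, written on the left. **Ordered groupoids.** An ordered groupoid is a groupoid $\mathcal G$ with a partial order $\leq$ (on morphisms) such that: (O1) $a\leq b$ implies $\mathbf d(a)\leq\mathbf d(b)$ and $\mathbf r(a)\leq\mathbf r(b)$; (O2) $a\leq b$ implies $a^{-1}\leq b^{-1}$; (O3) if $a\leq b$, $c\leq d$, $\mathbf r(a)=\mathbf d(c)$, $\mathbf r(b)=\mathbf d(d)$, then $a\circ c\leq b\circ d$; (O4) for every object $p\leq\mathbf d(a)$ there is a unique $u\leq a$ with $\mathbf d(u)=p$, denoted ${}_p\downharpoonleft a$. Then for every object $q\leq\mathbf r(a)$ there is a unique $w\leq a$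 with $\mathbf r(w)=q$, denoted $a\downharpoonright_q$. An ordered groupoid functor is an order-preserving functor. **Projection algebras.** A projection algebra is a set $P$ with maps $\theta_p:P\to P$ ($p\in P$) such that for all $p,q\in P$: $p\theta_p=p$; $\theta_p\theta_p=\theta_p$; $p\theta_q\theta_p=q\theta_p$; $\theta_p\theta_q\theta_p=\theta_{q\theta_p}$; $\theta_p\theta_q\theta_p\theta_q=\theta_p\theta_q$. Define $p\leq q\Leftrightarrow p=p\theta_q$ (a partial order), $p\leq_{\mathscr F}q\Leftrightarrow p=q\theta_p$, and $p\mathrel{\mathscr F}q\Leftrightarrow(p\leq_{\mathscr F}q$ and $q\leq_{\mathscr F}p)$. Write $p^\downarrow=\{q\in P:q\leq p\}$. A projection algebra morphism $\phi:P\to P'$ is a map with $(p\theta_q)\phi=(p\phi)\theta'_{q\phi}$ for all $p,q$. **Chain groupoid.** A $P$-path is a tuple $(p_1,\ldots,p_k)$, $k\geq1$, with $p_1\mathrel{\mathscr F}p_2\mathrel{\mathscr F}\cdots\mathrel{\mathscr F}p_k$; it is a morphism $p_1\to p_k$, and $(p_1,\ldots,p_k)\circ(p_k,\ldots,p_l)=(p_1,\ldots,p_k,\ldots,p_l)$. This gives the path category $\mathscr P(P)$ with object set $P$ ($p\equiv(p)$). For $q\leq p_1$ put ${}_q\downharpoonleft(p_1,\ldots,p_k)=(q_1,\ldots,q_k)$ where $q_1=q$, $q_i=q_{i-1}\theta_{p_i}$. Let $\approx$ be the congruence on $\mathscr P(P)$ generated by all pairs $((p,p),(p))$, and $((p,q,p),(p))$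 with $p\mathrel{\mathscr F}q$. The chain groupoid is $\mathscr C(P)=\mathscr P(P)/{\approx}$, with elements $[p_1,\ldots,p_k]$, inverses $[p_1,\ldots,p_k]^{-1}=[p_k,\ldots,p_1]$, object set $P$ ($p\equiv[p]$). It is an ordered groupoid under: $\mathfrak c\leq\mathfrak d$ iff there are paths $\mathfrak p\in\mathfrak c$, $\mathfrak q\in\mathfrak d$ with $\mathfrak p={}_r\downharpoonleft\mathfrak q$ for some $r\leq\mathbf d(\mathfrak q)$. **Projection groupoids.** A weak projection groupoid is a pair $(P,\mathcal G)$ where $\mathcal G$ is an ordered groupoid, $P=v\mathcal G$ is a projection algebra, and the order of $\mathcal G$ restricted to $P$ is the projection algebra order. For $a\in\mathcal G$ let $\vartheta_a:\mathbf d(a)^\downarrow\to\mathbf r(a)^\downarrow$, $p\vartheta_a=\mathbf r({}_p\downharpoonleft a)$, and $\Theta_a=\theta_{\mathbf d(a)}\vartheta_a:P\to P$. It is a projection groupoid if (G1) every $\vartheta_a$ is a projection algebra morphism, i.e. $(s\theta_t)\vartheta_a=(s\vartheta_a)\theta_{t\vartheta_a}$ for $s,t\leq\mathbf d(a)$. A projection groupoid morphism $(P,\mathcal G)\to(P',\mathcal G')$ is an ordered groupoid functor $\phi:\mathcal G\to\mathcal G'$ whose object map $v\phi:P\to P'$ is a projection algebra morphism. **Weak chained projection groupoids.** These are triples $(P,\mathcal G,\varepsilon)$ with $(P,\mathcal G)$ a projection groupoid and $\varepsilon:\mathscr C(P)\to\mathcal G$ an evaluation map, i.e. an order-preserving functor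 with $\varepsilon(p)=p$ for all $p\in P$. A chained projection functor $(P,\mathcal G,\varepsilon)\to(P',\mathcal G',\varepsilon')$ is a projection groupoid morphism $\phi$ with $(\varepsilon[p_1,\ldots,p_k])\phi=\varepsilon'[p_1\phi,\ldots,p_k\phi]$ for all $[p_1,\ldots,p_k]\in\mathscr C(P)$. **Chained projection groupoids.** For $b\in\mathcal G$ with $\mathbf d(b)=q$, $\mathbf r(b)=r$, a pair $(e,f)\in P\times P$ is $b$-linked if $f=e\Theta_b\theta_f$ and $e=f\Theta_{b^{-1}}\theta_e$. Then put $e_1=e\theta_q$, $e_2=f\Theta_{b^{-1}}$, $f_1=e\Theta_b$, $f_2=f\theta_r$ (one has $e\mathrel{\mathscr F}e_i\leq q$, $f\mathrel{\mathscr F}f_i\leq r$ and ${}_{e_i}\downharpoonleft b=b\downharpoonright_{f_i}$), and $\lambda(e,b,f)=\varepsilon[e,e_1]\circ{}_{e_1}\downharpoonleft b\circ\varepsilon[f_1,f]$, $\rho(e,b,f)=\varepsilon[e,e_2]\circ{}_{e_2}\downharpoonleft b\circ\varepsilon[f_2,f]$. A chained projection groupoid is a weak chained projection groupoid with (G2): $\lambda(e,b,f)=\rho(e,b,f)$ for every $b\in\mathcal G$ and every $b$-linked pair $(e,f)$. $\mathbf{CPG}$ is the category of chained projection groupoids with all chained projection functors between them. **The algebra $\mathbf S(P,\mathcal G,\varepsilon)$.** It has underlying set $\mathcal G$, unary operation $a^*=a^{-1}$, and product defined as follows: for $a,b\in\mathcal G$ with $p=\mathbf r(a)$, $q=\mathbf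 d(b)$, put $p'=q\theta_p$, $q'=p\theta_q$ (one has $p'\leq p$, $q'\leq q$, $p'\mathrel{\mathscr F}q'$) and $a\bullet b=a\downharpoonright_{p'}\circ\varepsilon[p',q']\circ{}_{q'}\downharpoonleft b$. *)

(* Defs.v *)
From Stdlib Require Import ClassicalEpsilon FunctionalExtensionality.
From Stdlib Require Import PropExtensionality ProofIrrelevance.
From mathcomp Require Import all_boot.

Set Implicit Arguments.
Unset Strict Implicit.
Unset Printing Implicit Defensive.

(* [compc f g] is the composite in left-to-right (diagrammatic) order. *)
Record category := Category {
  obj :> Type;
  hom : obj -> obj -> Type;
  idc : forall X, hom X X;
  compc : forall X Y Z, hom X Y -> hom Y Z -> hom X Z;
  id_compc : forall X Y (f : hom X Y), compc (idc X) f = f;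
  comp_idc : forall X Y (f : hom X Y), compc f (idc Y) = f;
  compcA : forall X Y Z W (f : hom X Y) (g : hom Y Z) (h : hom Z W),
    compc (compc f g) h = compc f (compc g h) }.

Arguments hom {c} X Y.
Arguments idc {c} X.
Arguments compc {c X Y Z} f g.

Record is_functor (C D : category) (F : C -> D)
    (Fhom : forall X Y : C, hom X Y -> hom (F X) (F Y)) : Prop := IsFunctor {
  functor_id : forall X : C, Fhom X X (idc X) = idc (F X);
  functor_comp : forall (X Y Z : C) (f : hom X Y) (g : hom Y Z),
    Fhom X Z (compc f g) = compc (Fhom X Y f) (Fhom Y Z g) }.

Record star_algebra := StarAlgebra {
  carrier :> Type;
  smul : carrier -> carrier -> carrier;
  star : carrier -> carrier }.

Record is_regular_star_semigroup (S : star_algebra) : Prop := IsRSS {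
  smulA : forall a b c : S, smul a (smul b c) = smul (smul a b) c;
  starK : forall a : S, star (star a) = a;
  smul_star_smul : forall a : S, smul (smul a (star a)) a = a;
  star_smul : forall a b : S, star (smul a b) = smul (star b) (star a) }.

Record regular_star_semigroup := RSSPack {
  rss_alg :> star_algebra;
  rss_ax : is_regular_star_semigroup rss_alg }.

Record is_star_morphism (S T : star_algebra) (f : S -> T) : Prop :=
  IsStarMorphism {
    morph_smul : forall a b : S, f (smul a b) = smul (f a) (f b);
    morph_star : forall a : S, f (star a) = star (f a) }.

Record star_morphism (S T : star_algebra) := StarMorphism {
  star_fun :> S -> T;
  star_funP : is_star_morphism star_fun }.

Lemma star_morphism_eq (S T : star_algebra) (f g : star_morphism S T) :
  star_fun f = star_fun g -> f = g.
Proof.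
by case: f g => [f Hf] [g Hg] /= E; subst g; rewrite (proof_irrelevance _ Hf Hg).
Qed.

Lemma star_id_subproof (S : star_algebra) : is_star_morphism (fun a : S => a).
Proof. by split. Qed.

Lemma star_comp_subproof (S T U : star_algebra)
    (f : star_morphism S T) (g : star_morphism T U) :
  is_star_morphism (fun a => g (f a)).
Proof.
by case: f g => [f [fM fS]] [g [gM gS]]; split=> [a b|a] /=;
  rewrite ?fM ?gM ?fS ?gS.
Qed.

Definition star_id (S : star_algebra) := StarMorphism (star_id_subproof S).

Definition star_comp (S T U : star_algebra)
    (f : star_morphism S T) (g : star_morphism T U) :=
  StarMorphism (star_comp_subproof f g).

Definition RSS : category.
Proof.
refine (@Category regular_star_semigroup
  (fun S T => star_morphism S T) (fun S => star_id S)
  (fun S T U f g => star_comp f g) _ _ _).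
all: by move=> *; exact: star_morphism_eq.
Defined.

(* [comp a b H] is the partial composite, in left-to-right order; it is only
   available with a proof [H] that [a] and [b] are composable. *)
Record groupoid (P : Type) := Groupoid {
  mor :> Type;
  dom : mor -> P;
  cod : mor -> P;
  idm : P -> mor;
  comp : forall a b : mor, cod a = dom b -> mor;
  inv : mor -> mor;
  dom_id : forall p, dom (idm p) = p;
  cod_id : forall p, cod (idm p) = p;
  dom_comp : forall a b (H : cod a = dom b), dom (comp H) = dom a;
  cod_comp : forall a b (H : cod a = dom b), cod (comp H) = cod b;
  comp1m : forall a (H : cod (idm (dom a)) = dom a), comp H = a;
  compm1 : forall a (H : cod a = dom (idm (cod a))), comp H = a;
  compmA : forall a b c (Hab : cod a = dom b) (Hbc : cod b = dom c)
      (Hl : cod (comp Hab) = dom c) (Hr : cod a = dom (comp Hbc)),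
    comp Hl = comp Hr;
  dom_inv : forall a, dom (inv a) = cod a;
  cod_inv : forall a, cod (inv a) = dom a;
  compmV : forall a (H : cod a = dom (inv a)), comp H = idm (dom a);
  compVm : forall a (H : cod (inv a) = dom a), comp H = idm (cod a) }.

Arguments dom {P g} a.
Arguments cod {P g} a.
Arguments idm {P} g p.
Arguments comp {P g} a b H.
Arguments inv {P g} a.

Record is_ordered (P : Type) (G : groupoid P) (le : G -> G -> Prop) : Prop :=
  IsOrdered {
    le_refl : forall a, le a a;
    le_anti : forall a b, le a b -> le b a -> a = b;
    le_trans : forall a b c, le a b -> le b c -> le a c;
    le_O1 : forall a b, le a b ->
      le (idm G (dom a)) (idm G (dom b)) /\ le (idm G (cod a)) (idm G (cod b));
    le_O2 : forall a b, le a b -> le (inv a) (inv b);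
    le_O3 : forall a b c d (Hac : cod a = dom c) (Hbd : cod b = dom d),
      le a b -> le c d -> le (comp a c Hac) (comp b d Hbd);
    le_O4 : forall a p, le (idm G p) (idm G (dom a)) ->
      exists! u, le u a /\ dom u = p }.

Record ordered_groupoid (P : Type) := OrderedGroupoid {
  og_gpd :> groupoid P;
  le : og_gpd -> og_gpd -> Prop;
  og_ax : is_ordered le }.

Arguments le {P o} a b.

Definition ole (P : Type) (G : ordered_groupoid P) (p q : P) : Prop :=
  le (idm G p) (idm G q).

(* These are total functions, characterised by [lrestrP] and [rrestrP] when
   [p <= dom a], respectively [q <= cod a], and unspecified otherwise. *)
Definition lrestr (P : Type) (G : ordered_groupoid P) (p : P) (a : G) : G :=
  epsilon (inhabits a) (fun u => le u a /\ dom u = p).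

Definition rrestr (P : Type) (G : ordered_groupoid P) (a : G) (q : P) : G :=
  epsilon (inhabits a) (fun w => le w a /\ cod w = q).

Section OrderedGroupoidTheory.
Variables (P : Type) (G : ordered_groupoid P).
Implicit Types (a b u w : G) (p q : P).

Lemma idm_inj p q : idm G p = idm G q -> p = q.
Proof. by move=> E; rewrite -(dom_id G p) E dom_id. Qed.

Lemma comp_irr a b (H H' : cod a = dom b) : comp a b H = comp a b H'.
Proof. by rewrite (proof_irrelevance _ H H'). Qed.

Lemma comp_congr a a' b b' (H : cod a = dom b) (H' : cod a' = dom b') :
  a = a' -> b = b' -> comp a b H = comp a' b' H'.
Proof. by move=> Ea Eb; subst a' b'; exact: comp_irr. Qed.

Lemma inv_unique a b (H : cod a = dom b) :
  comp a b H = idm G (dom a) -> b = inv a.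
Proof.
move=> E.
have Hv : cod (inv a) = dom a by exact: cod_inv.
have H1 : cod (inv a) = dom (comp a b H) by rewrite dom_comp.
have H2 : cod (comp (inv a) a Hv) = dom b by rewrite cod_comp.
have H3 : cod (idm G (dom b)) = dom b by exact: cod_id.
have H4 : cod (inv a) = dom (idm G (cod (inv a))) by rewrite dom_id.
rewrite -(comp1m H3) -[RHS](compm1 H4).
transitivity (comp (comp (inv a) a Hv) b H2).
  by apply: comp_congr => //; rewrite compVm H.
by rewrite (compmA H2 H1); apply: comp_congr => //; rewrite E Hv.
Qed.

Lemma invK a : inv (inv a) = a.
Proof.
have H : cod (inv a) = dom a by exact: cod_inv.
by symmetry; apply: (@inv_unique _ _ H); rewrite compVm dom_inv.
Qed.

Lemma lrestrP a p :
  ole G p (dom a) -> le (lrestr p a) a /\ dom (lrestr p a) = p.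
Proof.
move=> Hp; apply: (epsilon_spec (inhabits a) (fun u => le u a /\ dom u = p)).
by have [u [Hu _]] := le_O4 (og_ax G) Hp; exists u.
Qed.

Lemma lrestr_unique a p u :
  ole G p (dom a) -> le u a -> dom u = p -> lrestr p a = u.
Proof.
move=> Hp Hu Du; have [v [_ Hv]] := le_O4 (og_ax G) Hp.
by rewrite -(Hv _ (lrestrP Hp)) (Hv u).
Qed.

Lemma rrestr_exists a q :
  ole G q (cod a) -> exists! w, le w a /\ cod w = q.
Proof.
move=> Hq; have Hq' : ole G q (dom (inv a)) by rewrite dom_inv.
have [u [[Hu Du] Uu]] := le_O4 (og_ax G) Hq'.
exists (inv u); split.
  by rewrite cod_inv; split=> //; rewrite -[a]invK; exact: (le_O2 (og_ax G)).
move=> w [Hw Cw]; rewrite (Uu (inv w)) ?invK // dom_inv; split=> //.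
exact: (le_O2 (og_ax G)).
Qed.

Lemma rrestrP a q :
  ole G q (cod a) -> le (rrestr a q) a /\ cod (rrestr a q) = q.
Proof.
move=> Hq; apply: (epsilon_spec (inhabits a) (fun w => le w a /\ cod w = q)).
by have [w [Hw _]] := rrestr_exists Hq; exists w.
Qed.

Lemma rrestr_unique a q w :
  ole G q (cod a) -> le w a -> cod w = q -> rrestr a q = w.
Proof.
move=> Hq Hw Cw; have [v [_ Hv]] := rrestr_exists Hq.
by rewrite -(Hv _ (rrestrP Hq)) (Hv w).
Qed.

End OrderedGroupoidTheory.

(* [fun_ob] is the object map v(phi), which is determined by [fun_mor]. *)
Record og_functor (P Q : Type) (G : ordered_groupoid P)
    (H : ordered_groupoid Q) := OGFunctor {
  fun_ob : P -> Q;
  fun_mor :> G -> H;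
  fun_dom : forall a, dom (fun_mor a) = fun_ob (dom a);
  fun_cod : forall a, cod (fun_mor a) = fun_ob (cod a);
  fun_id : forall p, fun_mor (idm G p) = idm H (fun_ob p);
  fun_comp : forall a b (C : cod a = dom b) (C' : cod (fun_mor a) = dom (fun_mor b)),
    fun_mor (comp a b C) = comp (fun_mor a) (fun_mor b) C';
  fun_le : forall a b, le a b -> le (fun_mor a) (fun_mor b) }.

Lemma og_functor_eq (P Q : Type) (G : ordered_groupoid P)
    (H : ordered_groupoid Q) (f g : og_functor G H) :
  fun_mor f = fun_mor g -> f = g.
Proof.
move=> E.
have Eo : fun_ob f = fun_ob g.
  apply: functional_extensionality => p.
  by apply: (@idm_inj _ H); rewrite -!fun_id E.
case: f g E Eo => [fo fm f1 f2 f3 f4 f5] [go gm g1 g2 g3 g4 g5] /= E Eo.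
by subst go gm; f_equal; exact: proof_irrelevance.
Qed.

Definition og_id (P : Type) (G : ordered_groupoid P) : og_functor G G.
Proof.
apply: (@OGFunctor _ _ G G id id) => // a b C C'; exact: comp_irr.
Defined.

Definition og_comp (P Q R : Type) (G : ordered_groupoid P)
    (H : ordered_groupoid Q) (K : ordered_groupoid R)
    (f : og_functor G H) (g : og_functor H K) : og_functor G K.
Proof.
apply: (@OGFunctor _ _ G K (fun p => fun_ob g (fun_ob f p)) (fun a => g (f a))).
- by move=> a; rewrite !fun_dom.
- by move=> a; rewrite !fun_cod.
- by move=> p; rewrite !fun_id.
- move=> a b C C'.
  have D : cod (f a) = dom (f b) by rewrite fun_cod fun_dom C.
  by rewrite (fun_comp (o := f) C D); exact: fun_comp.
- by move=> a b Hab; apply: fun_le; exact: fun_le.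
Defined.

(* [proj_th p x], written [x \th_ p], is x theta_p. *)
Record projection_algebra := ProjectionAlgebra {
  proj :> Type;
  proj_th : proj -> proj -> proj;
  proj_P1 : forall p, proj_th p p = p;
  proj_P2 : forall p x, proj_th p (proj_th p x) = proj_th p x;
  proj_P3 : forall p q, proj_th p (proj_th q p) = proj_th p q;
  proj_P4 : forall p q x,
    proj_th p (proj_th q (proj_th p x)) = proj_th (proj_th p q) x;
  proj_P5 : forall p q x,
    proj_th q (proj_th p (proj_th q (proj_th p x))) = proj_th q (proj_th p x) }.

Notation "x '\th_' p" := (proj_th p x)
  (at level 40, p at level 2, left associativity, format "x  '\th_' p").

Definition proj_le (P : projection_algebra) (p q : P) : Prop := p = p \th_q.
Definition proj_leF (P : projection_algebra) (p q : P) : Prop := p = q \th_p.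
Definition proj_F (P : projection_algebra) (p q : P) : Prop :=
  proj_leF p q /\ proj_leF q p.

Section ProjectionAlgebraTheory.
Variable P : projection_algebra.
Implicit Types p q r s t x : P.

Lemma proj_le_refl p : proj_le p p.
Proof. by rewrite /proj_le proj_P1. Qed.

Lemma proj_le_trans s t u : proj_le s t -> @proj_le P t u -> proj_le s u.
Proof.
rewrite /proj_le => Hs Ht.
have E : s = s \th_u \th_t \th_u by rewrite proj_P4 -Ht.
by rewrite E proj_P2 -E.
Qed.

Lemma proj_le_anti p q : proj_le p q -> proj_le q p -> p = q.
Proof.
by rewrite /proj_le => Hp Hq; rewrite [RHS]Hq -[RHS]proj_P3 -Hp proj_P1.
Qed.

Lemma th_le x p : proj_le (x \th_p) p.
Proof. by rewrite /proj_le proj_P2. Qed.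

Lemma th_mono s t p : proj_le s t -> proj_le (s \th_p) (t \th_p).
Proof.
by rewrite /proj_le => Hs; rewrite -proj_P4 proj_P2 {2}Hs proj_P5 -Hs.
Qed.

Lemma F_refl p : proj_F p p.
Proof. by split; rewrite /proj_leF proj_P1. Qed.

Lemma F_sym p q : proj_F p q -> proj_F q p.
Proof. by case. Qed.

Lemma th_F p q : proj_F (q \th_p) (p \th_q).
Proof.
by split; rewrite /proj_leF -proj_P4 proj_P5 proj_P3.
Qed.

Lemma le_leF p q r : proj_le p q -> proj_leF q r -> proj_leF p r.
Proof.
rewrite /proj_le /proj_leF => Hp Hq.
by rewrite {2}Hp -proj_P4 -Hq proj_P3 -Hp.
Qed.

Lemma leF_le p q r : proj_leF p q -> proj_le q r -> proj_leF p r.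
Proof.
rewrite /proj_leF => Hp Hq; apply: proj_le_anti; last exact: th_le.
by rewrite {1}Hp; exact: th_mono.
Qed.

Lemma restr_F q p p' : proj_le q p -> proj_F p p' -> proj_F q (q \th_p').
Proof.
move=> Hq [Hp _]; have E := le_leF Hq Hp; split.
  by rewrite /proj_leF proj_P3.
by rewrite /proj_leF -proj_P4 proj_P3 -E.
Qed.

Lemma restr_back q p p' :
  proj_le q p -> proj_F p p' -> q \th_p' \th_p = q.
Proof.
by move=> Hq [Hp _]; rewrite {1}Hq proj_P4 -Hp -Hq.
Qed.

End ProjectionAlgebraTheory.

Fixpoint Fchain (P : projection_algebra) (x : P) (s : seq P) : Prop :=
  if s is y :: s' then proj_F x y /\ Fchain y s' else True.

(* The path (p_1, ..., p_k) is stored as p_1 and [:: p_2; ...; p_k]. *)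
Record ppath (P : projection_algebra) := PPath {
  phd : P;
  ptl : seq P;
  pathF : Fchain phd ptl }.

Arguments PPath {P} phd ptl pathF.

Section Paths.
Variable P : projection_algebra.
Implicit Types (x y p q r : P) (s t : seq P) (a b c d : ppath P).

Definition pdom a : P := phd a.
Definition pcod a : P := last (phd a) (ptl a).

Lemma Fchain_cat x s t :
  Fchain x (s ++ t) <-> Fchain x s /\ Fchain (last x s) t.
Proof.
by elim: s x => [|y s IH] x /=; [tauto | rewrite IH; tauto].
Qed.

Lemma pcomp_subproof a b : pcod a = pdom b -> Fchain (phd a) (ptl a ++ ptl b).
Proof.
move=> E; apply/Fchain_cat; split; first exact: pathF.
by move: E; rewrite /pcod /pdom => ->; exact: pathF.
Qed.

Definition pid p : ppath P := PPath p [::] I.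

Definition pcomp a b (H : pcod a = pdom b) : ppath P :=
  PPath (phd a) (ptl a ++ ptl b) (pcomp_subproof H).

Definition ppair p q (H : proj_F p q) : ppath P := PPath p [:: q] (conj H I).

Definition ptriple p q (H : proj_F p q) : ppath P :=
  PPath p [:: q; p] (conj H (conj (F_sym H) I)).

Lemma Fchain_rev x s : Fchain x s -> Fchain (last x s) (rev (belast x s)).
Proof.
elim: s x => [|y s IH] x //= [Hxy Hs].
rewrite rev_cons -cats1; apply/Fchain_cat; split; first exact: IH.
have -> : last (last y s) (rev (belast y s)) = y.
  by case: s {IH Hs} => //= z s; rewrite rev_cons last_rcons.
by split=> //; exact: F_sym.
Qed.

Definition prev a : ppath P :=
  PPath (pcod a) (rev (belast (phd a) (ptl a))) (Fchain_rev (pathF a)).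

(* [restr_tl q [:: p_2; ...; p_k]] is [:: q_2; ...; q_k], where q_1 = q and
   q_i = q_(i-1) theta_(p_i). *)
Fixpoint restr_tl q s : seq P :=
  if s is p :: s' then (q \th_p) :: restr_tl (q \th_p) s' else [::].

Lemma restr_tl_F q p s : proj_le q p -> Fchain p s -> Fchain q (restr_tl q s).
Proof.
elim: s q p => [|p' s IH] q p //= Hq [Hp Hs]; split; first exact: restr_F Hq Hp.
by apply: IH Hs; exact: th_le.
Qed.

Definition prestr q a (H : proj_le q (pdom a)) : ppath P :=
  PPath q (restr_tl q (ptl a)) (restr_tl_F H (pathF a)).

(* The congruence on the path category generated by the pairs
   ((p,p),(p)), and ((p,q,p),(p)) for p F q. *)
Inductive approx : ppath P -> ppath P -> Prop :=
| approx_double p : approx (ppair (F_refl p)) (pid p)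
| approx_triple p q (H : proj_F p q) : approx (ptriple H) (pid p)
| approx_refl a : approx a a
| approx_sym a b : approx a b -> approx b a
| approx_trans a b c : approx a b -> approx b c -> approx a c
| approx_comp a a' b b' (H : pcod a = pdom b) (H' : pcod a' = pdom b') :
    approx a a' -> approx b b' -> approx (pcomp H) (pcomp H').

Definition chain : Type := {C : ppath P -> Prop | exists a, C = approx a}.

Definition chain_class a : chain := exist _ (approx a) (ex_intro _ a erefl).

Definition chain_repr (c : chain) : ppath P :=
  proj1_sig (constructive_indefinite_description _ (proj2_sig c)).

Definition chain_dom (c : chain) : P := pdom (chain_repr c).
Definition chain_cod (c : chain) : P := pcod (chain_repr c).
Definition chain_id p : chain := chain_class (pid p).
Definition chain_comp (c d : chain) (H : chain_cod c = chain_dom d) : chain :=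
  chain_class (pcomp H).
Definition chain_inv (c : chain) : chain := chain_class (prev (chain_repr c)).
Definition chain_le (c d : chain) : Prop :=
  exists a b r (H : proj_le r (pdom b)),
    [/\ chain_class a = c, chain_class b = d & a = prestr H].

Lemma ppath_eq a b : phd a = phd b -> ptl a = ptl b -> a = b.
Proof.
case: a b => [x s Hs] [y t Ht] /= E1 E2; subst y t.
by rewrite (proof_irrelevance _ Hs Ht).
Qed.

Lemma approx_dom a b : approx a b -> pdom a = pdom b.
Proof. by elim=> //= *; etransitivity; eauto. Qed.

Lemma pcod_pcomp a b (H : pcod a = pdom b) : pcod (pcomp H) = pcod b.
Proof. by move: H; rewrite /pcod /pdom /= last_cat => ->. Qed.

Lemma approx_cod a b : approx a b -> pcod a = pcod b.
Proof.
elim=> // [? ? ? _ -> _ ->|? ? ? ? H H' _ _ _ E] //.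
by rewrite !pcod_pcomp.
Qed.

Lemma chain_class_eq a b : chain_class a = chain_class b <-> approx a b.
Proof.
split=> [[E]|H]; first by rewrite E; exact: approx_refl.
have E : approx a = approx b.
  apply: functional_extensionality => c; apply: propositional_extensionality.
  by split=> Hc; [apply: approx_trans (approx_sym H) Hc
                 | apply: approx_trans H Hc].
rewrite /chain_class; move: (ex_intro _ a _) (ex_intro _ b _).
by rewrite E => u v; rewrite (proof_irrelevance _ u v).
Qed.

Lemma chain_reprK (c : chain) : chain_class (chain_repr c) = c.
Proof.
rewrite /chain_repr; case: constructive_indefinite_description => a /=.
case: c => C HC /= E; subst C.
by rewrite /chain_class (proof_irrelevance _ HC (ex_intro _ a erefl)).
Qed.

Lemma chain_repr_class a : approx (chain_repr (chain_class a)) a.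
Proof. by apply/chain_class_eq; exact: chain_reprK. Qed.

Lemma chain_dom_class a : chain_dom (chain_class a) = pdom a.
Proof. exact: approx_dom (chain_repr_class a). Qed.

Lemma chain_cod_class a : chain_cod (chain_class a) = pcod a.
Proof. exact: approx_cod (chain_repr_class a). Qed.

Lemma chain_comp_class a b
    (H : chain_cod (chain_class a) = chain_dom (chain_class b))
    (H' : pcod a = pdom b) :
  chain_comp H = chain_class (pcomp H').
Proof.
by apply/chain_class_eq; apply: approx_comp; exact: chain_repr_class.
Qed.

Lemma prev_dom a : pdom (prev a) = pcod a. Proof. by []. Qed.

Lemma prev_cod a : pcod (prev a) = pdom a.
Proof.
case: a => x [|y s] // Hs; rewrite /pcod /prev /=.
by rewrite rev_cons last_rcons.
Qed.

Lemma approx_pcompV_aux x s (H : Fchain x s)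
    (H' : Fchain x (s ++ rev (belast x s))) :
  approx (PPath x (s ++ rev (belast x s)) H') (pid x).
Proof.
elim: s x H H' => [|y s IH] x /=; first by move=> _ []; exact: approx_refl.
move=> [Hxy Hs] H'.
have Hm : Fchain y (s ++ rev (belast y s)).
  by apply/Fchain_cat; split=> //; exact: Fchain_rev.
have A := IH y Hs Hm.
have E1 : pcod (PPath y _ Hm) = pdom (ppair (F_sym Hxy)).
  by rewrite (approx_cod A).
have E2 : pcod (ppair Hxy) = pdom (pcomp E1) by [].
have E3 : pcod (pid y) = pdom (ppair (F_sym Hxy)) by [].
have E4 : pcod (ppair Hxy) = pdom (pcomp E3) by [].
rewrite (_ : PPath x (y :: s ++ rev (x :: belast y s)) H' = pcomp E2); last first.
  by apply: ppath_eq => //=; rewrite rev_cons -cats1 catA.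
apply: (@approx_trans _ (pcomp E4)).
  by apply: approx_comp; [exact: approx_refl|apply: approx_comp=> //; exact: approx_refl].
have -> : pcomp E4 = ptriple Hxy by exact: ppath_eq.
exact: approx_triple.
Qed.

Lemma approx_pcompV a (H : pcod a = pdom (prev a)) :
  approx (pcomp H) (pid (pdom a)).
Proof. by case: a H => x s Hs H; exact: approx_pcompV_aux Hs _. Qed.

Lemma prevK a : prev (prev a) = a.
Proof.
apply: ppath_eq; first exact: prev_cod.
case: a => x s Hs; rewrite /= /pcod /=; move: s {Hs}.
elim/last_ind=> [|s z _] //.
by rewrite last_rcons belast_rcons rev_cons belast_rcons rev_cons revK.
Qed.

Lemma prev_pcomp a b (H : pcod a = pdom b) (H' : pcod (prev b) = pdom (prev a)) :
  prev (pcomp H) = pcomp H'.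
Proof.
apply: ppath_eq => /=; first exact: pcod_pcomp.
by rewrite belast_cat rev_cat; move: H; rewrite /pcod => ->.
Qed.

Lemma approx_prev a b : approx a b -> approx (prev a) (prev b).
Proof.
have Eid p : prev (pid p) = pid p by exact: ppath_eq.
elim=> {a b}.
- move=> p; rewrite Eid; have -> : prev (ppair (F_refl p)) = ppair (F_refl p) by exact: ppath_eq.
  exact: approx_double.
- move=> p q H; rewrite Eid; have -> : prev (ptriple H) = ptriple H by exact: ppath_eq.
  exact: approx_triple.
- by move=> a; exact: approx_refl.
- by move=> a b _; exact: approx_sym.
- by move=> a b c _ H1 _; exact: approx_trans H1.
- move=> a a' b b' H H' _ Ha _ Hb.
  have K : pcod (prev b) = pdom (prev a) by rewrite prev_cod prev_dom.
  have K' : pcod (prev b') = pdom (prev a') by rewrite prev_cod prev_dom.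
  by rewrite (prev_pcomp H K) (prev_pcomp H' K'); exact: approx_comp.
Qed.

Lemma chain_inv_class a : chain_inv (chain_class a) = chain_class (prev a).
Proof. by apply/chain_class_eq; apply: approx_prev; exact: chain_repr_class. Qed.

Lemma chain_ind_class (Q : chain -> Prop) :
  (forall a, Q (chain_class a)) -> forall c : chain, Q c.
Proof. by move=> H c; rewrite -(chain_reprK c). Qed.

Definition chain_gpd : groupoid P.
Proof.
apply: (@Groupoid P chain chain_dom chain_cod chain_id chain_comp chain_inv).
- by move=> p; rewrite chain_dom_class.
- by move=> p; rewrite chain_cod_class.
- by move=> c d H; rewrite chain_dom_class.
- by move=> c d H; rewrite chain_cod_class pcod_pcomp.
- elim/chain_ind_class=> a H.
  have K : pcod (pid (chain_dom (chain_class a))) = pdom a.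
    by rewrite chain_dom_class.
  rewrite (chain_comp_class H K); congr chain_class.
  by apply: ppath_eq; rewrite //= chain_dom_class.
- elim/chain_ind_class=> a H.
  have K : pcod a = pdom (pid (chain_cod (chain_class a))).
    by rewrite chain_cod_class.
  rewrite (chain_comp_class H K); congr chain_class.
  by apply: ppath_eq; rewrite //= cats0.
- elim/chain_ind_class=> a; elim/chain_ind_class=> b; elim/chain_ind_class=> c.
  move=> Hab Hbc Hl Hr.
  have Kab : pcod a = pdom b by rewrite -chain_cod_class Hab chain_dom_class.
  have Kbc : pcod b = pdom c by rewrite -chain_cod_class Hbc chain_dom_class.
  have Kl : pcod (pcomp Kab) = pdom c by rewrite pcod_pcomp.
  have Kr : pcod a = pdom (pcomp Kbc) by [].
  move: Hl Hr; rewrite (chain_comp_class Hab Kab) (chain_comp_class Hbc Kbc).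
  move=> Hl Hr; rewrite (chain_comp_class Hl Kl) (chain_comp_class Hr Kr).
  by congr chain_class; apply: ppath_eq; rewrite //= catA.
- by move=> c; rewrite chain_dom_class.
- by move=> c; rewrite chain_cod_class prev_cod.
- elim/chain_ind_class=> a; rewrite chain_inv_class => H.
  have K : pcod a = pdom (prev a) by [].
  rewrite (chain_comp_class H K) chain_dom_class.
  by apply/chain_class_eq; exact: approx_pcompV.
- elim/chain_ind_class=> a; rewrite chain_inv_class => H.
  have K : pcod (prev a) = pdom a by rewrite prev_cod.
  rewrite (chain_comp_class H K) chain_cod_class.
  apply/chain_class_eq.
  have K' : pcod (prev a) = pdom (prev (prev a)) by [].
  have -> : pcomp K = pcomp K'.
    apply: ppath_eq => //.
    by rewrite -[RHS]/(ptl (prev a) ++ ptl (prev (prev a))) prevK.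
  exact: approx_pcompV.
Defined.

Lemma pcod_prestr q a (H : proj_le q (pdom a)) :
  proj_le (pcod (prestr H)) (pcod a).
Proof.
case: a H => x s Hs; rewrite /pcod /pdom /= => H.
elim: s x q H {Hs} => //= y s IH x q _.
by apply: IH; exact: th_le.
Qed.

Lemma restr_tl_cat q s t :
  restr_tl q (s ++ t) = restr_tl q s ++ restr_tl (last q (restr_tl q s)) t.
Proof. by elim: s q => //= y s IH q; rewrite IH. Qed.

Lemma prestr_pcomp q a b (H : pcod a = pdom b) (Hq : proj_le q (pdom (pcomp H)))
    (Ha : proj_le q (pdom a)) (Hb : proj_le (pcod (prestr Ha)) (pdom b))
    (K : pcod (prestr Ha) = pdom (prestr Hb)) :
  prestr Hq = pcomp K.
Proof. by apply: ppath_eq => //=; exact: restr_tl_cat. Qed.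

Lemma prestr_congr q q' a a' (H : proj_le q (pdom a)) (H' : proj_le q' (pdom a')) :
  q = q' -> a = a' -> prestr H = prestr H'.
Proof. by move=> E E'; subst q' a'; exact: ppath_eq. Qed.

Lemma approx_prestr a b : approx a b ->
  forall q (Ha : proj_le q (pdom a)) (Hb : proj_le q (pdom b)),
    approx (prestr Ha) (prestr Hb).
Proof.
elim=> {a b}.
- move=> p q Ha Hb.
  have -> : prestr Ha = ppair (F_refl q) by apply: ppath_eq => //=; rewrite -Hb.
  have -> : prestr Hb = pid q by exact: ppath_eq.
  exact: approx_double.
- move=> p p' H q Ha Hb; have K := restr_F Hb H.
  have -> : prestr Ha = ptriple K.
    by apply: ppath_eq => //=; rewrite (restr_back Hb H).
  have -> : prestr Hb = pid q by exact: ppath_eq.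
  exact: approx_triple.
- by move=> a q Ha Hb; rewrite (prestr_congr Ha Hb) //; exact: approx_refl.
- by move=> a b _ IH q Ha Hb; apply: approx_sym.
- move=> a b c Hab IH1 _ IH2 q Ha Hc.
  have Hb : proj_le q (pdom b) by rewrite -(approx_dom Hab).
  exact: approx_trans (IH1 q Ha Hb) (IH2 q Hb Hc).
- move=> a a' b b' H H' Haa' IHa Hbb' IHb q Hq Hq'.
  have Kb : proj_le (pcod (prestr (a := a) Hq)) (pdom b).
    by rewrite -H; exact: pcod_prestr.
  have E := approx_cod (IHa q Hq Hq').
  have Kb' : proj_le (pcod (prestr (a := a') Hq')) (pdom b').
    by rewrite -H'; exact: pcod_prestr.
  have K : pcod (prestr (a := a) Hq) = pdom (prestr Kb) by [].
  have K' : pcod (prestr (a := a') Hq') = pdom (prestr Kb') by [].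
  rewrite (prestr_pcomp Hq K) (prestr_pcomp Hq' K').
  apply: approx_comp; first exact: IHa.
  have Kb2 : proj_le (pcod (prestr (a := a) Hq)) (pdom b') by rewrite E.
  apply: approx_trans (IHb _ Kb Kb2) _.
  by rewrite (prestr_congr Kb2 Kb' E erefl); exact: approx_refl.
Qed.

Lemma chain_leP (c : chain) b : chain_le c (chain_class b) <->
  exists r (H : proj_le r (pdom b)), c = chain_class (prestr H).
Proof.
split=> [[a [b' [r [H [<- /chain_class_eq E ->]]]]]|[r [H ->]]]; last first.
  by exists (prestr H), b, r, H.
have H' : proj_le r (pdom b) by rewrite -(approx_dom E).
by exists r, H'; apply/chain_class_eq; exact: approx_prestr.
Qed.

Lemma restr_tl_rev q x s : proj_le q x -> Fchain x s ->
  rev (belast q (restr_tl q s)) =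
  restr_tl (last q (restr_tl q s)) (rev (belast x s)).
Proof.
elim: s q x => //= y s IH q x Hq [Hxy Hs].
have Hy := th_le q y.
rewrite !rev_cons (IH _ _ Hy Hs) -!cats1 restr_tl_cat /=; congr (_ ++ [:: _]).
rewrite -(IH _ _ Hy Hs).
have -> : last (last (q \th_y) (restr_tl (q \th_y) s))
               (rev (belast (q \th_y) (restr_tl (q \th_y) s))) = q \th_y.
  by case: (restr_tl _ s) => //= z t; rewrite rev_cons last_rcons.
by rewrite (restr_back Hq Hxy).
Qed.

Lemma prev_prestr q a (H : proj_le q (pdom a))
    (H' : proj_le (pcod (prestr H)) (pdom (prev a))) :
  prev (prestr H) = prestr H'.
Proof. by apply: ppath_eq => //=; exact: restr_tl_rev H (pathF a). Qed.

Lemma restr_tl_id x s : Fchain x s -> restr_tl x s = s.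
Proof. by elim: s x => //= y s IH x [[_ Hy] Hs]; rewrite -Hy IH. Qed.

Lemma restr_tl_restr q r s x : proj_le q r -> proj_le r x -> Fchain x s ->
  restr_tl q (restr_tl r s) = restr_tl q s.
Proof.
elim: s q r x => //= y s IH q r x Hq Hr [Hxy Hs].
have E : q \th_(r \th_y) = q \th_y.
  have Er : y \th_r = r by symmetry; exact: le_leF Hr Hxy.1.
  by rewrite -proj_P4 {1}Hq (proj_P4 r) Er -Hq.
rewrite E; congr cons; apply: IH Hs; last exact: th_le.
exact: th_mono.
Qed.

Lemma chain_le_id p q : chain_le (chain_id p) (chain_id q) <-> proj_le p q.
Proof.
rewrite chain_leP; split=> [[r [H /chain_class_eq E]]|H].
  by rewrite -[p]/(pdom (pid p)) (approx_dom E).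
have H' : proj_le p (pdom (pid q)) by [].
by exists p, H'; congr chain_class; exact: ppath_eq.
Qed.

Lemma chain_ordered : @is_ordered P chain_gpd chain_le.
Proof.
split.
- elim/chain_ind_class=> a; apply/chain_leP.
  exists (pdom a), (proj_le_refl (pdom a)).
  by congr chain_class; apply: ppath_eq; rewrite //= restr_tl_id //; exact: pathF.
- elim/chain_ind_class=> a; elim/chain_ind_class=> b.
  move=> /chain_leP [r [H E]] /chain_leP [r' [H' E']].
  have D := approx_dom (proj1 (chain_class_eq _ _) E).
  have D' := approx_dom (proj1 (chain_class_eq _ _) E').
  rewrite /= in D D'; rewrite E.
  have Er : r = pdom b by apply: proj_le_anti => //; rewrite -D D'.
  congr chain_class; apply: ppath_eq => //=; rewrite Er.
  exact: restr_tl_id (pathF b).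
- move=> c1 c2 c3; elim/chain_ind_class: c3 => c.
  move=> + /chain_leP [r [H E]]; subst c2 => /chain_leP [r' [H' ->]].
  have K : proj_le r' (pdom c) by exact: proj_le_trans H' H.
  apply/chain_leP; exists r', K; congr chain_class; apply: ppath_eq => //=.
  exact: restr_tl_restr H' H (pathF c).
- move=> c; elim/chain_ind_class=> a /chain_leP [r [H ->]]; split; apply/chain_le_id.
    by rewrite /= !chain_dom_class.
  by rewrite /= !chain_cod_class; exact: pcod_prestr.
- move=> c; elim/chain_ind_class=> a /chain_leP [r [H ->]].
  rewrite /= !chain_inv_class; apply/chain_leP.
  have K : proj_le (pcod (prestr H)) (pdom (prev a)) by exact: pcod_prestr.
  by exists (pcod (prestr H)), K; rewrite prev_prestr.
- move=> c b c' d; elim/chain_ind_class: b => b; elim/chain_ind_class: d => d /=.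
  move=> + + /chain_leP [r [H E]] /chain_leP [r' [H' E']]; subst c c' => Hac Hbd.
  have Kbd : pcod b = pdom d by rewrite -chain_cod_class Hbd chain_dom_class.
  have Kac : pcod (prestr H) = pdom (prestr H').
    by rewrite -chain_cod_class Hac chain_dom_class.
  rewrite (chain_comp_class Hac Kac) (chain_comp_class Hbd Kbd).
  apply/chain_leP; exists r, H; congr chain_class; apply: ppath_eq => //=.
  by rewrite restr_tl_cat; congr (_ ++ restr_tl _ _).
- elim/chain_ind_class=> a p; rewrite /= chain_dom_class => /chain_le_id H.
  exists (chain_class (prestr H)); split.
    by rewrite chain_dom_class; split=> //; apply/chain_leP; exists p, H.
  move=> c [/chain_leP [r [H' ->]]]; rewrite chain_dom_class /= => E; subst r.
  by congr chain_class; exact: ppath_eq.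
Qed.

Definition chain_groupoid : ordered_groupoid P := OrderedGroupoid chain_ordered.

End Paths.

Lemma ppath_map_subproof (P Q : projection_algebra) (f : P -> Q)
    (Hf : forall p q, f (p \th_q) = f p \th_(f q)) (a : ppath P) :
  Fchain (f (phd a)) (map f (ptl a)).
Proof.
case: a => x s /=; elim: s x => //= y s IH x [[H1 H2] Hs]; split; last exact: IH.
by split; rewrite /proj_leF -Hf -?H1 -?H2.
Qed.

Definition ppath_map (P Q : projection_algebra) (f : P -> Q)
    (Hf : forall p q, f (p \th_q) = f p \th_(f q)) (a : ppath P) : ppath Q :=
  PPath (f (phd a)) (map f (ptl a)) (ppath_map_subproof Hf a).

Record weak_projection_groupoid := WeakProjectionGroupoid {
  pgP : projection_algebra;
  pgG :> ordered_groupoid pgP;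
  pg_le : forall p q : pgP, ole pgG p q <-> proj_le p q }.

(* [vth a p] is p vartheta_a, meaningful for [p <= dom a]; [bigTh a p] is
   p Theta_a. *)
Definition vth (X : weak_projection_groupoid) (a : X) (p : pgP X) : pgP X :=
  cod (lrestr p a).

Definition bigTh (X : weak_projection_groupoid) (a : X) (p : pgP X) : pgP X :=
  vth a (p \th_(dom a)).

Definition axiom_G1 (X : weak_projection_groupoid) : Prop :=
  forall (a : X) (s t : pgP X), proj_le s (dom a) -> proj_le t (dom a) ->
    vth a (s \th_t) = vth a s \th_(vth a t).

Record projection_groupoid := ProjectionGroupoid {
  pg_weak :> weak_projection_groupoid;
  pg_G1 : axiom_G1 pg_weak }.

Record pg_morphism (X Y : projection_groupoid) := PGMorphism {
  pgm_fun :> og_functor X Y;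
  pgm_th : forall p q : pgP X,
    fun_ob pgm_fun (p \th_q) = fun_ob pgm_fun p \th_(fun_ob pgm_fun q) }.

Record weak_cpg := WeakCPG {
  cpg_pg :> projection_groupoid;
  ev : og_functor (chain_groupoid (pgP cpg_pg)) cpg_pg;
  ev_id : forall p, ev (idm (chain_groupoid (pgP cpg_pg)) p) = idm cpg_pg p }.

Arguments ev {w}.

(* [ev2 H] is epsilon[p, q]. *)
Definition ev2 (X : weak_cpg) (p q : pgP X) (H : proj_F p q) : X :=
  ev (chain_class (ppair H)).

Record chained_functor (X Y : weak_cpg) := ChainedFunctor {
  chf_fun :> pg_morphism X Y;
  chf_ev : forall a : ppath (pgP X),
    chf_fun (ev (chain_class a)) =
    ev (chain_class (ppath_map (pgm_th chf_fun) a)) }.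

Definition linked (X : weak_projection_groupoid) (b : X) (e f : pgP X) : Prop :=
  f = bigTh b e \th_f /\ e = bigTh (inv b) f \th_e.

Section WeakTheory.
Variable X : weak_projection_groupoid.
Implicit Types (a b : X) (p q e f s t : pgP X).

Lemma lrestr_le p a : proj_le p (dom a) -> le (lrestr p a) a.
Proof. by move=> Hp; case: (lrestrP (proj2 (pg_le _ _) Hp)). Qed.

Lemma dom_lrestr p a : proj_le p (dom a) -> dom (lrestr p a) = p.
Proof. by move=> Hp; case: (lrestrP (proj2 (pg_le _ _) Hp)). Qed.

Lemma cod_rrestr a q : proj_le q (cod a) -> cod (rrestr a q) = q.
Proof. by move=> Hp; case: (rrestrP (proj2 (pg_le _ _) Hp)). Qed.

Lemma vth_le a p : proj_le p (dom a) -> proj_le (vth a p) (cod a).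
Proof.
by move=> Hp; apply/pg_le; exact: (le_O1 (og_ax X) (lrestr_le Hp)).2.
Qed.

Lemma vthK a p : proj_le p (dom a) -> vth (inv a) (vth a p) = p.
Proof.
move=> Hp; rewrite /vth.
have Hq : ole X (cod (lrestr p a)) (dom (inv a)).
  by rewrite dom_inv; apply/pg_le; exact: vth_le.
rewrite (lrestr_unique Hq (le_O2 (og_ax X) (lrestr_le Hp)) (dom_inv _)).
by rewrite cod_inv dom_lrestr.
Qed.

Lemma bigTh_le a p : proj_le (bigTh a p) (cod a).
Proof. by apply: vth_le; exact: th_le. Qed.

Lemma bigTh_inv_le b f : proj_le (bigTh (inv b) f) (dom b).
Proof. by rewrite -(cod_inv b); exact: bigTh_le. Qed.

Lemma vth_bigTh_inv b f : vth b (bigTh (inv b) f) = f \th_(cod b).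
Proof.
rewrite /bigTh -{1}(invK b) vthK ?dom_inv //.
exact: th_le.
Qed.

Lemma linked_inv b e f : linked b e f -> linked (inv b) f e.
Proof. by case=> H1 H2; split; rewrite ?invK. Qed.

Lemma linked_F_e1 b e f : linked b e f -> proj_F e (e \th_(dom b)).
Proof.
case=> _ He; have L : proj_leF e (dom b) by exact: leF_le He (bigTh_inv_le b f).
split; first by rewrite /proj_leF proj_P3.
by rewrite /proj_leF -proj_P4 proj_P3 -L.
Qed.

Hypothesis G1 : axiom_G1 X.

Lemma linked_F_f1 b e f : linked b e f -> proj_F (bigTh b e) f.
Proof.
move=> [Hf He]; split; last exact: Hf.
set f1 := bigTh b e; set e2 := bigTh (inv b) f in He.
have He2 : proj_le e2 (dom b) by exact: bigTh_inv_le.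
have He1 : proj_le (e \th_(dom b)) (dom b) by exact: th_le.
have Hf1 : proj_le f1 (cod b) by exact: bigTh_le.
have E : e2 \th_(e \th_(dom b)) = e \th_(dom b).
  by rewrite -proj_P4 -He2 -He.
have := G1 He2 He1; rewrite E vth_bigTh_inv -/(bigTh b e) -/f1 => E1.
rewrite /proj_leF {1}E1.
have T x : x \th_f1 = x \th_(cod b) \th_f1.
  have T1 y : y \th_f1 = y \th_(cod b) \th_f1 \th_(cod b).
    by rewrite proj_P4 -Hf1.
  rewrite T1 [in RHS]T1 proj_P2; by [].
by rewrite [in RHS]T.
Qed.

Lemma linked_F_e2 b e f : linked b e f -> proj_F e (bigTh (inv b) f).
Proof. by move=> /linked_inv L; apply: F_sym; exact: linked_F_f1 L. Qed.

Lemma linked_F_f2 b e f : linked b e f -> proj_F (f \th_(cod b)) f.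
Proof.
by move=> /linked_inv /linked_F_e1; rewrite dom_inv; exact: F_sym.
Qed.

End WeakTheory.

Section Chained.
Variable X : weak_cpg.
Implicit Types (a b : X) (p q e f : pgP X).

Lemma ev_ob p : fun_ob ev p = p.
Proof. by apply: (@idm_inj _ X); rewrite -fun_id ev_id. Qed.

Lemma dom_ev2 p q (H : proj_F p q) : dom (ev2 H) = p.
Proof. by rewrite /ev2 fun_dom ev_ob /= chain_dom_class. Qed.

Lemma cod_ev2 p q (H : proj_F p q) : cod (ev2 H) = q.
Proof. by rewrite /ev2 fun_cod ev_ob /= chain_cod_class. Qed.

Lemma bridge_subproof1 p p' (H : proj_F p p') b :
  proj_le p' (dom b) -> cod (ev2 H) = dom (lrestr p' b).
Proof. by move=> Hp; rewrite cod_ev2 dom_lrestr. Qed.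

Lemma bridge_subproof2 p p' (H : proj_F p p') b (Hp : proj_le p' (dom b))
    q' q (H' : proj_F q' q) : vth b p' = q' ->
  cod (comp (ev2 H) (lrestr p' b) (bridge_subproof1 H Hp)) = dom (ev2 H').
Proof. by move=> E; rewrite cod_comp dom_ev2. Qed.

(* epsilon[p, p'] o b' o epsilon[q', q], where b' is the left restriction of b
   to p'. *)
Definition bridge p p' (H : proj_F p p') b (Hp : proj_le p' (dom b))
    q' q (H' : proj_F q' q) (E : vth b p' = q') : X :=
  comp (comp (ev2 H) (lrestr p' b) (bridge_subproof1 H Hp)) (ev2 H')
       (bridge_subproof2 H Hp H' E).

(* Here p' is e_1 = e theta_q and q' is f_1 = e Theta_b. *)
Definition lam b e f (L : linked b e f) : X :=
  bridge (linked_F_e1 L) (th_le e (dom b))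
         (linked_F_f1 (@pg_G1 X) L) (erefl (bigTh b e)).

(* Here p' is e_2 = f Theta_(b^-1) and q' is f_2 = f theta_r. *)
Definition rho b e f (L : linked b e f) : X :=
  bridge (linked_F_e2 (@pg_G1 X) L) (bigTh_inv_le b f)
         (linked_F_f2 L) (vth_bigTh_inv b f).

Definition axiom_G2 : Prop :=
  forall b e f (L : linked b e f), lam L = rho L.

Lemma bullet_subproof1 a b :
  cod (rrestr a (dom b \th_(cod a))) = dom (ev2 (th_F (cod a) (dom b))).
Proof. by rewrite cod_rrestr ?dom_ev2 //; exact: th_le. Qed.

Lemma bullet_subproof2 a b :
  cod (comp (rrestr a (dom b \th_(cod a))) (ev2 (th_F (cod a) (dom b)))
            (bullet_subproof1 a b))
  = dom (lrestr (cod a \th_(dom b)) b).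
Proof. by rewrite cod_comp cod_ev2 dom_lrestr //; exact: th_le. Qed.

Definition bullet a b : X :=
  comp (comp (rrestr a (dom b \th_(cod a))) (ev2 (th_F (cod a) (dom b)))
             (bullet_subproof1 a b))
       (lrestr (cod a \th_(dom b)) b) (bullet_subproof2 a b).

Definition S_alg : star_algebra := @StarAlgebra X bullet (@inv _ X).

End Chained.

Record chained_projection_groupoid := ChainedProjectionGroupoid {
  cpg_weak :> weak_cpg;
  cpg_G2 : axiom_G2 cpg_weak }.

Lemma chained_functor_eq (X Y : weak_cpg) (f g : chained_functor X Y) :
  (forall a : X, f a = g a) -> f = g.
Proof.
move=> E; case: f g E => [[f Hf] Hf'] [[g Hg] Hg'] /= E.
have Efg : f = g.
  by apply: og_functor_eq; exact: functional_extensionality.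
subst g; have Ep := proof_irrelevance _ Hf Hg; subst Hg.
by rewrite (proof_irrelevance _ Hf' Hg').
Qed.

Definition pg_id (X : projection_groupoid) : pg_morphism X X :=
  @PGMorphism X X (og_id X) (fun _ _ => erefl).

Lemma pg_comp_subproof (X Y Z : projection_groupoid) (f : pg_morphism X Y)
    (g : pg_morphism Y Z) (p q : pgP X) :
  fun_ob (og_comp f g) (p \th_q)
  = fun_ob (og_comp f g) p \th_(fun_ob (og_comp f g) q).
Proof. by rewrite /= !pgm_th. Qed.

Definition pg_comp (X Y Z : projection_groupoid) (f : pg_morphism X Y)
    (g : pg_morphism Y Z) : pg_morphism X Z :=
  PGMorphism (pg_comp_subproof f g).

Lemma chained_id_subproof (X : weak_cpg) (a : ppath (pgP X)) :
  pg_id X (ev (chain_class a)) =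
  ev (chain_class (ppath_map (pgm_th (pg_id X)) a)).
Proof.
by rewrite /=; congr (ev (chain_class _)); apply: ppath_eq; rewrite //= map_id.
Qed.

Lemma chained_comp_subproof (X Y Z : weak_cpg) (f : chained_functor X Y)
    (g : chained_functor Y Z) (a : ppath (pgP X)) :
  pg_comp f g (ev (chain_class a)) =
  ev (chain_class (ppath_map (pgm_th (pg_comp f g)) a)).
Proof.
rewrite /= !chf_ev; congr (ev (chain_class _)).
by apply: ppath_eq; rewrite //= -map_comp.
Qed.

Definition chained_id (X : weak_cpg) : chained_functor X X :=
  ChainedFunctor (@chained_id_subproof X).

Definition chained_comp (X Y Z : weak_cpg) (f : chained_functor X Y)
    (g : chained_functor Y Z) : chained_functor X Z :=
  ChainedFunctor (chained_comp_subproof f g).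

Definition CPG : category.
Proof.
refine (@Category chained_projection_groupoid
  (fun X Y => chained_functor X Y) (fun X => chained_id X)
  (fun X Y Z f g => chained_comp f g) _ _ _).
all: by move=> *; apply: chained_functor_eq.
Defined.

(* Main.v *)
(** Both bracketings of a triple product restrict to [a|_e o m o _f|c] for a
    common pair (e, f), with a middle factor [m] going from e to f through b.
    Put [p = cod a] and [s = dom c].  The identity
    [theta_(p Theta_b) = Theta_(b^-1) theta_p Theta_b], a consequence of (G1),
    shows that [e = s Theta_(b^-1) theta_p] and [f = p Theta_b theta_s] are
    b-linked and that the middle factor of [(a b) c] is [lambda(e, b, f)];
    inversion then shows that the middle factor of [a (b c)] is
    [rho(e, b, f)], and (G2) identifies the two. *)
From Stdlib Require Import ClassicalEpsilon.
From mathcomp Require Import all_boot.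
Require Import Defs.

Set Implicit Arguments.
Unset Strict Implicit.
Unset Printing Implicit Defensive.

(* Junk value [a] when [cod a <> dom b]; being total spares all further
   statements the composability proofs carried by [comp]. *)
Definition tcomp (P : Type) (G : groupoid P) (a b : G) : G :=
  if excluded_middle_informative (cod a = dom b) is left H then comp a b H
  else a.

Notation "a ** b" := (tcomp a b) (at level 40, left associativity).

(** * Groupoid calculus for the totalised composition *)

Section TotalComposition.
Variables (P : Type) (G : ordered_groupoid P).
Implicit Types (a b c d e : G) (p : P).

Lemma tcompE a b (H : cod a = dom b) : comp a b H = a ** b.
Proof.
by rewrite /tcomp; case: excluded_middle_informative => // K; exact: comp_irr.
Qed.

Lemma dom_tcomp a b : cod a = dom b -> dom (a ** b) = dom a.
Proof. by move=> H; rewrite -(tcompE H) dom_comp. Qed.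

Lemma cod_tcomp a b : cod a = dom b -> cod (a ** b) = cod b.
Proof. by move=> H; rewrite -(tcompE H) cod_comp. Qed.

Lemma tcompA a b c : cod a = dom b -> cod b = dom c ->
  a ** b ** c = a ** (b ** c).
Proof.
move=> Hab Hbc.
have Hl : cod (comp a b Hab) = dom c by rewrite cod_comp.
have Hr : cod a = dom (comp b c Hbc) by rewrite dom_comp.
by rewrite -(tcompE Hab) -(tcompE Hbc) -(tcompE Hl) -(tcompE Hr) (compmA Hl Hr).
Qed.

Lemma tcomp1m a p : dom a = p -> idm G p ** a = a.
Proof.
move=> <-; have H : cod (idm G (dom a)) = dom a by exact: cod_id.
by rewrite -(tcompE H) comp1m.
Qed.

Lemma tcompm1 a p : cod a = p -> a ** idm G p = a.
Proof.
move=> <-; have H : cod a = dom (idm G (cod a)) by rewrite dom_id.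
by rewrite -(tcompE H) compm1.
Qed.

Lemma tcompmV a : a ** inv a = idm G (dom a).
Proof.
have H : cod a = dom (inv a) by rewrite dom_inv.
by rewrite -(tcompE H) compmV.
Qed.

Lemma inv_tcomp_unique a b :
  cod a = dom b -> a ** b = idm G (dom a) -> inv a = b.
Proof. by move=> H E; symmetry; apply: (inv_unique (H := H)); rewrite tcompE. Qed.

(** Right inverses are unique, so it suffices that [inv b ** inv a] cancels [a ** b] on the
    right. *)
Lemma inv_tcomp a b : cod a = dom b -> inv (a ** b) = inv b ** inv a.
Proof.
move=> H; have H' : cod (inv b) = dom (inv a) by rewrite cod_inv dom_inv.
have Hb : cod b = dom (inv b) by rewrite dom_inv.
apply: inv_tcomp_unique; first by rewrite cod_tcomp // dom_tcomp.
rewrite tcompA // ?dom_tcomp // -[b ** (inv b ** inv a)]tcompA //.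
by rewrite tcompmV tcomp1m ?tcompmV // dom_inv.
Qed.

(** Groups the three middle factors, which have the shape of [lam] and [rho], between the two outer
    restrictions. *)
Lemma tcompA5 a b c d e :
  cod a = dom b -> cod b = dom c -> cod c = dom d -> cod d = dom e ->
  a ** b ** c ** d ** e = a ** (b ** c ** d) ** e.
Proof.
move=> Hab Hbc Hcd Hde.
have Habc : cod (a ** b) = dom c by rewrite cod_tcomp.
have Hbcd : cod (b ** c) = dom d by rewrite cod_tcomp.
by rewrite (tcompA Hab Hbc) (tcompA (b := b ** c)) // dom_tcomp.
Qed.

Lemma inv_tcomp5 a b c d e :
  cod a = dom b -> cod b = dom c -> cod c = dom d -> cod d = dom e ->
  inv (a ** (b ** c ** d) ** e) =
  inv e ** (inv d ** inv c ** inv b) ** inv a.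
Proof.
move=> Hab Hbc Hcd Hde.
have Hbcd : cod (b ** c) = dom d by rewrite cod_tcomp.
have Ha : cod a = dom (b ** c ** d) by rewrite !dom_tcomp.
have Hd : cod (a ** (b ** c ** d)) = dom e by rewrite !cod_tcomp.
have V (x y : G) : cod x = dom y -> cod (inv y) = dom (inv x).
  by move=> E; rewrite cod_inv dom_inv.
rewrite (inv_tcomp Hd) (inv_tcomp Ha) (inv_tcomp Hbcd) (inv_tcomp Hbc).
have [Vab Vbc Vcd Vde] := And4 (V _ _ Hab) (V _ _ Hbc) (V _ _ Hcd) (V _ _ Hde).
by rewrite -(tcompA Vcd Vbc) -tcompA ?dom_tcomp ?cod_tcomp.
Qed.

Lemma le_tcomp a b c d : cod a = dom c -> cod b = dom d ->
  le a b -> le c d -> le (a ** c) (b ** d).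
Proof.
by move=> Hac Hbd; rewrite -(tcompE Hac) -(tcompE Hbd); exact: (le_O3 (og_ax G)).
Qed.

End TotalComposition.

(** * Functors, totalised composition and inverses *)

Section FunctorTotalComposition.
Variables (P Q : Type) (G : ordered_groupoid P) (H : ordered_groupoid Q).
Variable phi : og_functor G H.

Lemma fun_tcomp (a b : G) : cod a = dom b -> phi (a ** b) = phi a ** phi b.
Proof.
move=> C; have C' : cod (phi a) = dom (phi b) by rewrite fun_cod fun_dom C.
by rewrite -(tcompE C) -(tcompE C') fun_comp.
Qed.

Lemma fun_inv (a : G) : phi (inv a) = inv (phi a).
Proof.
have C : cod a = dom (inv a) by rewrite dom_inv.
symmetry; apply: inv_tcomp_unique; first by rewrite fun_cod fun_dom C.
by rewrite -fun_tcomp // tcompmV fun_id fun_dom.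
Qed.

End FunctorTotalComposition.

(** * Restrictions, and the linked pair attached to a triple *)

Section Restriction.
Variable X : weak_projection_groupoid.
Implicit Types (a b u : X) (p q s t : pgP X).

Lemma le_dom u a : le u a -> proj_le (dom u) (dom a).
Proof. by move=> H; apply/pg_le; exact: (le_O1 (og_ax X) H).1. Qed.

Lemma le_cod u a : le u a -> proj_le (cod u) (cod a).
Proof. by move=> H; apply/pg_le; exact: (le_O1 (og_ax X) H).2. Qed.

Lemma lrestr_eq u a p : le u a -> dom u = p -> lrestr p a = u.
Proof. by move=> H E; apply: lrestr_unique => //; apply/pg_le; rewrite -E; exact: le_dom. Qed.

Lemma rrestr_eq u a q : le u a -> cod u = q -> rrestr a q = u.
Proof. by move=> H E; apply: rrestr_unique => //; apply/pg_le; rewrite -E; exact: le_cod. Qed.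

Lemma rrestr_le a q : proj_le q (cod a) -> le (rrestr a q) a.
Proof. by move=> Hq; case: (rrestrP (proj2 (pg_le _ _) Hq)). Qed.

Lemma inv_lrestr a p : proj_le p (dom a) -> inv (lrestr p a) = rrestr (inv a) p.
Proof.
move=> Hp; symmetry; apply: rrestr_eq; last by rewrite cod_inv dom_lrestr.
by apply: (le_O2 (og_ax X)); exact: lrestr_le.
Qed.

Lemma inv_rrestr a q : proj_le q (cod a) -> inv (rrestr a q) = lrestr q (inv a).
Proof.
by move=> Hq; rewrite -[a in LHS]invK -inv_lrestr ?invK // dom_inv.
Qed.

Lemma lrestr_id a : lrestr (dom a) a = a.
Proof. by apply: lrestr_eq => //; exact: (le_refl (og_ax X)). Qed.

Lemma rrestr_id a : rrestr a (cod a) = a.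
Proof. by apply: rrestr_eq => //; exact: (le_refl (og_ax X)). Qed.

Lemma rrestr_vth a p :
  proj_le p (dom a) -> rrestr a (vth a p) = lrestr p a.
Proof. by move=> Hp; apply: rrestr_eq => //; exact: lrestr_le. Qed.

Lemma lrestr_lrestr a p q :
  proj_le p q -> proj_le q (dom a) -> lrestr p (lrestr q a) = lrestr p a.
Proof.
move=> Hpq Hq; have Hp : proj_le p (dom (lrestr q a)) by rewrite dom_lrestr.
symmetry; apply: lrestr_eq; last exact: dom_lrestr.
exact: (le_trans (og_ax X)) (lrestr_le Hp) (lrestr_le Hq).
Qed.

Lemma lrestr_mono a p q :
  proj_le p q -> proj_le q (dom a) -> le (lrestr p a) (lrestr q a).
Proof.
by move=> Hpq Hq; rewrite -(lrestr_lrestr Hpq Hq); apply: lrestr_le; rewrite dom_lrestr.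
Qed.

(** Inversion exchanges left and right restrictions, which reduces this to [lrestr_mono]. *)
Lemma rrestr_mono a p q :
  proj_le p q -> proj_le q (cod a) -> le (rrestr a p) (rrestr a q).
Proof.
move=> Hpq Hq; have Hp := proj_le_trans Hpq Hq.
have Hq' : proj_le q (dom (inv a)) by rewrite dom_inv.
rewrite -[rrestr a p]invK -[rrestr a q]invK !inv_rrestr //.
by apply: (le_O2 (og_ax X)); exact: lrestr_mono.
Qed.

Hypothesis G1 : axiom_G1 X.

(** Since [bigTh a p] lies below [cod a], [t] may be replaced by [t \th_(cod a)], the image of
    [bigTh (inv a) t] under [vth a]; (G1) then pulls [vth a] outside. *)
Lemma th_bigTh a p t : t \th_(bigTh a p) = bigTh a (bigTh (inv a) t \th_p).
Proof.
have L := bigTh_inv_le a t.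
have -> : t \th_(bigTh a p) = t \th_(cod a) \th_(bigTh a p).
  (* When y <= z, theta_y = theta_z theta_y theta_z, so a preceding theta_z is absorbed by
     idempotence. *)
  have T (x y z : pgP X) : proj_le y z -> x \th_y = x \th_z \th_y \th_z.
    by move=> H; rewrite proj_P4 -H.
  have H := bigTh_le a p.
  by rewrite [LHS](T _ _ _ H) [RHS](T _ _ _ H) proj_P2.
rewrite -vth_bigTh_inv -G1 //; last exact: th_le.
(* On elements below d = dom a, theta_(p theta_d) acts as theta_p followed by theta_d. *)
by rewrite -proj_P4 -L.
Qed.

(** Writing (e, f) for the pair, [th_bigTh] gives e Theta_b = s theta_(p Theta_b), which is
    F-related to f = p Theta_b theta_s by [th_F]. The other condition is the same statement for the
    inverse of [b]. *)
Lemma linked_triple b p s :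
  linked b (bigTh (inv b) s \th_p) (bigTh b p \th_s).
Proof.
split; first by rewrite -th_bigTh; exact: (th_F _ _).2.
by have := th_bigTh (inv b) s p; rewrite invK => <-; exact: (th_F _ _).2.
Qed.

End Restriction.

(** * The product: inversion, associativity and the semigroup axioms *)

Section Chained.
Variable X : weak_cpg.
Implicit Types (a b c : X) (p q r e f : pgP X).

(* epsilon[p, q] when p F q, with junk value the identity at p otherwise. *)
Definition pev p q : X :=
  if excluded_middle_informative (proj_F p q) is left H then ev2 H
  else idm X p.

Lemma ev2E p q (H : proj_F p q) : ev2 H = pev p q.
Proof.
rewrite /pev; case: excluded_middle_informative => // K.
by rewrite (proof_irrelevance _ H K).
Qed.

Lemma dom_pev p q : proj_F p q -> dom (pev p q) = p.
Proof. by move=> H; rewrite -(ev2E H) dom_ev2. Qed.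

Lemma cod_pev p q : proj_F p q -> cod (pev p q) = q.
Proof. by move=> H; rewrite -(ev2E H) cod_ev2. Qed.

Lemma pev_id p : pev p p = idm X p.
Proof.
rewrite -(ev2E (F_refl p)) -ev_id /ev2; congr (ev _).
by apply/chain_class_eq; exact: approx_double.
Qed.

Lemma inv_pev p q : proj_F p q -> inv (pev p q) = pev q p.
Proof.
move=> H; rewrite -(ev2E H) -(ev2E (F_sym H)) /ev2 -fun_inv.
by rewrite /= chain_inv_class; congr (ev (chain_class _)); exact: ppath_eq.
Qed.

(** The path (p, q) restricts to (r, r theta_q), and evaluation preserves order. *)
Lemma le_pev r p q :
  proj_F p q -> proj_le r p -> le (pev r (r \th_q)) (pev p q).
Proof.
move=> H Hr; rewrite -(ev2E H) -(ev2E (restr_F Hr H)); apply: fun_le.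
have K : proj_le r (pdom (ppair H)) by [].
by apply/chain_leP; exists r, K; congr chain_class; exact: ppath_eq.
Qed.

Lemma bulletE a b : bullet a b =
  rrestr a (dom b \th_(cod a)) ** pev (dom b \th_(cod a)) (cod a \th_(dom b))
    ** lrestr (cod a \th_(dom b)) b.
Proof. by rewrite /bullet !tcompE ev2E. Qed.

Lemma lamE b e f (L : linked b e f) : lam L =
  pev e (e \th_(dom b)) ** lrestr (e \th_(dom b)) b ** pev (bigTh b e) f.
Proof. by rewrite /lam /bridge !tcompE !ev2E. Qed.

Lemma rhoE b e f (L : linked b e f) : rho L =
  pev e (bigTh (inv b) f) ** lrestr (bigTh (inv b) f) b ** pev (f \th_(cod b)) f.
Proof. by rewrite /rho /bridge !tcompE !ev2E. Qed.

Lemma cod_bullet a b : cod (bullet a b) = bigTh b (cod a).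
Proof. by rewrite /bullet cod_comp. Qed.

(** Both restrictions are then trivial, and the connecting factor epsilon[p, p] is an identity. *)
Lemma bullet_tcomp a b : cod a = dom b -> bullet a b = a ** b.
Proof.
by move=> H; rewrite bulletE H !proj_P1 lrestr_id -H rrestr_id pev_id tcompm1.
Qed.

(** Inversion swaps the two restrictions and reverses the connecting factor, while the two
    projections exchange roles. *)
Lemma inv_bullet a b : inv (bullet a b) = bullet (inv b) (inv a).
Proof.
have F := th_F (cod a) (dom b).
have [La Lb] := (th_le (dom b) (cod a), th_le (cod a) (dom b)).
have Ca : cod (rrestr a (dom b \th_(cod a))) = dom (pev (dom b \th_(cod a)) (cod a \th_(dom b))).
  by rewrite cod_rrestr // dom_pev.
have Cb : cod (pev (dom b \th_(cod a)) (cod a \th_(dom b))) = dom (lrestr (cod a \th_(dom b)) b).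
  by rewrite cod_pev // dom_lrestr.
rewrite !bulletE dom_inv cod_inv inv_tcomp ?cod_tcomp // inv_tcomp //.
rewrite inv_lrestr // inv_pev // inv_rrestr // tcompA //.
- by rewrite cod_rrestr ?cod_inv // dom_pev //; exact: F_sym.
- by rewrite cod_pev ?dom_lrestr ?dom_inv //; exact: F_sym.
Qed.

Lemma bulletA_lam a b c
    (L : linked b (bigTh (inv b) (dom c) \th_(cod a)) (bigTh b (cod a) \th_(dom c))) :
  bullet (bullet a b) c =
  rrestr a (bigTh (inv b) (dom c) \th_(cod a)) ** lam L
    ** lrestr (bigTh b (cod a) \th_(dom c)) c.
Proof.
rewrite lamE; move: L; set p := cod a; set q := dom b; set s := dom c.
(* The left side is where [bullet a b] must be restricted on the right before meeting [c]; the right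
   side is e Theta_b. *)
have Eh := th_bigTh (@pg_G1 X) b p s.
set e := _ \th_p in Eh *; set f := _ \th_s => L.
have Hg : proj_le (bigTh (inv b) s) q := bigTh_inv_le b s.
have He : proj_le e p := th_le _ _.
have He' : proj_le e (q \th_p) := th_mono _ Hg.
have Fe : proj_F e (e \th_q) := linked_F_e1 L.
have Ff : proj_F (bigTh b e) f := linked_F_f1 (@pg_G1 X) L.
have F := th_F p q.
have C1 : cod (rrestr a e) = dom (pev e (e \th_q)) by rewrite cod_rrestr ?dom_pev.
have C2 : cod (pev e (e \th_q)) = dom (lrestr (e \th_q) b).
  by rewrite cod_pev // dom_lrestr //; exact: th_le.
have C3 : cod (lrestr (e \th_q) b) = dom (pev (bigTh b e) f) by rewrite dom_pev.
(* Right restrictions are unique, so it is enough that the three factors lie below those of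
   [bullet a b] and end at [bigTh b e]. *)
have R : rrestr (bullet a b) (bigTh b e) =
         rrestr a e ** pev e (e \th_q) ** lrestr (e \th_q) b.
  apply: rrestr_eq; last by rewrite cod_tcomp ?cod_tcomp.
  have D1 : cod (rrestr a (q \th_p)) = dom (pev (q \th_p) (p \th_q)).
    by rewrite cod_rrestr ?dom_pev //; exact: th_le.
  have D2 : cod (pev (q \th_p) (p \th_q)) = dom (lrestr (p \th_q) b).
    by rewrite cod_pev ?dom_lrestr //; exact: th_le.
  rewrite bulletE -/p -/q; apply: le_tcomp; rewrite ?cod_tcomp //.
    apply: le_tcomp => //; first by apply: rrestr_mono => //; exact: th_le.
    (* This puts the factor in the form required by [le_pev]; it holds because [e] is in the image
       of theta_p. *)
    have -> : e \th_q = e \th_(p \th_q) by rewrite -proj_P4 /e proj_P5.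
    exact: le_pev.
  by apply: lrestr_mono; [exact: th_mono|exact: th_le].
rewrite bulletE cod_bullet -/p -/s Eh R -/f.
have C4 : cod (pev (bigTh b e) f) = dom (lrestr f c).
  by rewrite cod_pev ?dom_lrestr //; exact: th_le.
exact: tcompA5.
Qed.

(** Apply [bulletA_lam] to the inverse triple, whose linked pair is (f, e), and invert: the inverse
    of lambda(f, b^-1, e) is rho(e, b, f). *)
Lemma bulletA_rho a b c
    (L : linked b (bigTh (inv b) (dom c) \th_(cod a)) (bigTh b (cod a) \th_(dom c))) :
  bullet a (bullet b c) =
  rrestr a (bigTh (inv b) (dom c) \th_(cod a)) ** rho L
    ** lrestr (bigTh b (cod a) \th_(dom c)) c.
Proof.
have L' := linked_triple (@pg_G1 X) (inv b) (cod (inv c)) (dom (inv a)).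
rewrite -[LHS]invK (inv_bullet a) (inv_bullet b) (bulletA_lam L') lamE rhoE.
rewrite !invK !dom_inv !cod_inv.
set e := _ \th_(cod a) in L *; set f := _ \th_(dom c) in L *.
have Fe := linked_F_e2 (@pg_G1 X) L.
have Ff := linked_F_f2 L.
have L2 := bigTh_inv_le b f.
have Lf : proj_le (f \th_(cod b)) (cod b) := th_le _ _.
have Le : proj_le e (cod a) := th_le _ _.
have Lf' : proj_le f (dom c) := th_le _ _.
(* By definition [bigTh (inv b) f] is the codomain of the left-hand restriction. *)
have Eb : lrestr (f \th_(cod b)) (inv b) = inv (lrestr (bigTh (inv b) f) b).
  by rewrite inv_lrestr // /bigTh dom_inv rrestr_vth // dom_inv.
rewrite Eb -(inv_rrestr Le) -(inv_pev Fe) -(inv_pev Ff).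
rewrite -[rrestr (inv c) f]inv_lrestr //.
have C1 : cod (rrestr a e) = dom (pev e (bigTh (inv b) f)).
  by rewrite cod_rrestr ?dom_pev.
have C2 : cod (pev e (bigTh (inv b) f)) = dom (lrestr (bigTh (inv b) f) b).
  by rewrite cod_pev // dom_lrestr.
have C3 : cod (lrestr (bigTh (inv b) f) b) = dom (pev (f \th_(cod b)) f).
  by rewrite dom_pev // -vth_bigTh_inv.
have C4 : cod (pev (f \th_(cod b)) f) = dom (lrestr f c).
  by rewrite cod_pev ?dom_lrestr.
by rewrite -(inv_tcomp5 C1 C2 C3 C4) invK.
Qed.

Lemma S_regular_star : axiom_G2 X -> is_regular_star_semigroup (S_alg X).
Proof.
move=> G2; split=> /= [a b c|a|a|a b].
- have L := linked_triple (@pg_G1 X) b (cod a) (dom c).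
  by rewrite (bulletA_lam L) (bulletA_rho L) G2.
- exact: invK.
- by rewrite (bullet_tcomp (a := a)) ?tcompmV ?dom_inv // bullet_tcomp ?tcomp1m // cod_id.
- exact: inv_bullet.
Qed.

End Chained.

(** * Chained projection functors preserve the product *)

Section ChainedFunctors.
Variables (X Y : weak_cpg) (phi : chained_functor X Y).
Implicit Types (a b : X) (p q : pgP X).

Lemma fun_lrestr a p : proj_le p (dom a) ->
  phi (lrestr p a) = lrestr (fun_ob phi p) (phi a).
Proof.
move=> Hp; symmetry; apply: lrestr_eq; last by rewrite fun_dom dom_lrestr.
by apply: fun_le; exact: lrestr_le.
Qed.

Lemma fun_rrestr a q : proj_le q (cod a) ->
  phi (rrestr a q) = rrestr (phi a) (fun_ob phi q).
Proof.
move=> Hq; symmetry; apply: rrestr_eq; last by rewrite fun_cod cod_rrestr.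
by apply: fun_le; exact: rrestr_le.
Qed.

Lemma fun_pev p q : proj_F p q ->
  phi (pev p q) = pev (fun_ob phi p) (fun_ob phi q).
Proof.
move=> F; have F' : proj_F (fun_ob phi p) (fun_ob phi q).
  by case: F => E1 E2; split; rewrite /proj_leF -pgm_th -?E1 -?E2.
rewrite -(ev2E F) -(ev2E F') /ev2 chf_ev.
by congr (ev (chain_class _)); exact: ppath_eq.
Qed.

(** The object map respects theta, so it carries the two restricting projections to those of the
    image product; the three factors are then preserved separately. *)
Lemma fun_bullet a b : phi (bullet a b) = bullet (phi a) (phi b).
Proof.
have F := th_F (cod a) (dom b).
have [La Lb] := (th_le (dom b) (cod a), th_le (cod a) (dom b)).
rewrite !bulletE !fun_dom !fun_cod -!pgm_th.
rewrite fun_tcomp ?fun_tcomp ?cod_tcomp ?cod_rrestr ?cod_pev ?dom_pev ?dom_lrestr //.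
by rewrite fun_rrestr // fun_pev // fun_lrestr.
Qed.

Lemma S_star_morphism :
  @is_star_morphism (S_alg X) (S_alg Y) (fun a => fun_mor phi a).
Proof. by split=> [a b|a]; [exact: fun_bullet|exact: fun_inv]. Qed.

End ChainedFunctors.

Theorem theorem7p14 :
  exists (S_ob : forall X : obj CPG, is_regular_star_semigroup (S_alg (cpg_weak X)))
         (S_mor : forall (X Y : obj CPG) (phi : @hom CPG X Y),
            @is_star_morphism (S_alg (cpg_weak X)) (S_alg (cpg_weak Y))
              (fun a => fun_mor phi a)),
    @is_functor CPG RSS
      (fun X => RSSPack (S_ob X))
      (fun X Y phi => StarMorphism (S_mor X Y phi)).
Proof.
exists (fun X => S_regular_star (@cpg_G2 X)),
  (fun (X Y : CPG) (phi : @hom CPG X Y) => S_star_morphism phi).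
(* Star morphisms are equal when their underlying maps are, and in both functor laws these maps
   agree by computation. *)
by split=> *; exact: star_morphism_eq.
Qed.
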